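(* Let $k\ge1$ and let $\mathcal{F}$ be a class of graphs of treewidth at most $k-1$ with $k$-recognisability index $C$. Then for all graphs $G$ and $H$ on at most $n$ vertices, $G\equiv_{\mathcal{F}}H$ if and only if $G\equiv_{\mathcal{F}_{\le f(n,k,C)}}H$, where $f(n,k,C):=\max\{k^{2Cn^k},\,2Cn^k\}$.
   Context: $\hom(F,G)$ is the number of homomorphisms $F\to G$; $G\equiv_{\mathcal{F}}H$ means $\hom(F,G)=\hom(F,H)$ for all $F\in\mathcal{F}$. For $\ell\in\mathbb{N}$, $\mathcal{F}_{\le\ell}:=\{F\in\mathcal{F} : |V(F)|\le\ell\}$. $\mathcal{D}(k)$ is the class of pairs $(F,\boldsymbol{u})$ with $\boldsymbol{u}\in V(F)^k$ having pairwise distinct entries; gluing $(F,\boldsymbol{u})\odot(F',\boldsymbol{u}')$ is the disjoint union with $u_i$ merged with $u'_i$ for all $i$; $\operatorname{soe}(F,\boldsymbol{u}):=F$. For a graph class $\mathcal{F}$, $\boldsymbol{F}_1\sim_{\mathcal{F}}\boldsymbol{F}_2$ iff for all $\boldsymbol{K}\in\mathcal{D}(k)$: $\operatorname{soe}(\boldsymbol{K}\odot\boldsymbol{F}_1)\in\mathcal{F}\iff\operatorname{soe}(\boldsymbol{K}\odot\boldsymbol{F}_2)\in\mathcal{F}$. The $k$-recognisability index of $\mathcal{F}$ is the (assumed finite) number of equivalence classes of $\sim_{\mathcal{F}}$. *)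

(* Defs.v *)
From mathcomp Require Import all_boot.

Set Implicit Arguments.
Unset Strict Implicit.
Unset Printing Implicit Defensive.

(** Finite undirected graphs without multiple edges.  [graph false] is the type
    of simple graphs; in [graph true] vertices may also carry loops. *)
Record graph (loops : bool) := Graph {
  vertex :> finType;
  edge : rel vertex;
  edge_sym : symmetric edge;
  edge_irr : ~~ loops -> irreflexive edge }.

Arguments edge {loops} g.

Definition graph_class (loops : bool) := graph loops -> Prop.

Section Homomorphisms.
Variable loops : bool.
Implicit Types (F G H : graph loops) (FF : graph_class loops).

Definition is_hom F G (h : {ffun F -> G}) : bool :=
  [forall u, forall v, edge F u v ==> edge G (h u) (h v)].

Definition hom F G : nat := #|[pred h : {ffun F -> G} | is_hom h]|.

Definition isomorphic F G : Prop :=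
  exists2 h : F -> G, bijective h & forall u v, edge G (h u) (h v) = edge F u v.

Definition iso_closed FF : Prop :=
  forall F F', isomorphic F F' -> FF F -> FF F'.

Definition hom_indist FF G H : Prop :=
  forall F, FF F -> hom F G = hom F H.

Definition class_le FF (l : nat) : graph_class loops :=
  fun F => FF F /\ #|F| <= l.

End Homomorphisms.

Definition connected_graph (T : graph false) : Prop :=
  0 < #|T| /\ forall s t : T, connect (edge T) s t.

(** Since [T] is simple, its cycles are the [ucycle]s with at least three
    vertices. *)
Definition acyclic_graph (T : graph false) : Prop :=
  forall c : seq T, ucycle (edge T) c -> size c < 3.

Definition is_tree (T : graph false) : Prop :=
  connected_graph T /\ acyclic_graph T.

Record is_tree_decomposition (loops : bool) (F : graph loops)
    (T : graph false) (bag : T -> {set F}) : Prop := IsTreeDecomposition {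
  td_tree : is_tree T;
  td_vertex : forall v : F, exists t, v \in bag t;
  td_edge : forall u v : F, edge F u v ->
    exists t, u \in bag t /\ v \in bag t;
  td_subtree : forall (v : F) (s t : T), v \in bag s -> v \in bag t ->
    connect [rel a b | [&& edge T a b, v \in bag a & v \in bag b]] s t }.

Definition treewidth_at_most (loops : bool) (F : graph loops) (w : nat) : Prop :=
  exists (T : graph false) (bag : T -> {set F}),
    is_tree_decomposition bag /\ forall t, #|bag t| <= w.+1.

Record labelled (loops : bool) (k : nat) := Labelled {
  soe : graph loops;
  label : 'I_k -> soe;
  label_inj : injective label }.

Arguments label {loops k} l.

Section Gluing.
Variables (loops : bool) (k : nat).

Definition unlabelled (F : labelled loops k) : finType :=
  {v : soe F | v \notin codom (label F)}.

Variables K F : labelled loops k.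

(** The disjoint union of [K] and [F] with [label K i] and [label F i] merged:
    a merged vertex is represented by the one it comes from in [K].  The maps
    [glue_l] and [glue_r] send a vertex to its image after merging. *)
Definition glue_vertex : finType := (soe K + unlabelled F)%type.

Definition glue_l (v : soe K) : glue_vertex := inl v.

Definition glue_r (v : soe F) : glue_vertex :=
  match boolP (v \in codom (label F)) with
  | AltTrue v_label => inl (label K (iinv v_label))
  | AltFalse v_unlabelled => inr (Sub v v_unlabelled)
  end.

Definition glue_edge : rel glue_vertex := fun x y =>
  [exists a, exists b, [&& edge (soe K) a b, glue_l a == x & glue_l b == y]]
  || [exists a, exists b, [&& edge (soe F) a b, glue_r a == x & glue_r b == y]].

Lemma glue_r_label i : glue_r (label F i) = glue_l (label K i).
Proof.
rewrite /glue_r; case: {-}_ / boolP => [h | /negP[]]; last exact: codom_f.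
by rewrite /glue_l; congr (inl (label K _)); apply: (@label_inj _ _ F); rewrite f_iinv.
Qed.

Lemma glue_r_inj : injective glue_r.
Proof.
move=> v w; rewrite /glue_r.
case: {-}_ / boolP => hv; case: {-}_ / boolP => hw //.
  by case=> /label_inj e; rewrite -(f_iinv hv) -(f_iinv hw) e.
by case.
Qed.

Lemma glue_edge_sym : symmetric glue_edge.
Proof.
suff imp x y : glue_edge x y -> glue_edge y x by move=> x y; apply/idP/idP; apply: imp.
case/orP=> /existsP[a /existsP[b /and3P[eab ax yb]]]; apply/orP; [left|right];
  by apply/existsP; exists b; apply/existsP; exists a; rewrite edge_sym eab ax yb.
Qed.

Lemma glue_edge_irr : ~~ loops -> irreflexive glue_edge.
Proof.
move=> nl x; apply/negP.
case/orP=> /existsP[a /existsP[b /and3P[eab /eqP <-]]].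
  by case/eqP=> eba; rewrite eba edge_irr in eab.
by move/eqP/glue_r_inj=> eba; rewrite eba edge_irr in eab.
Qed.

Definition glue_graph : graph loops := Graph glue_edge_sym glue_edge_irr.

Definition glue_label (i : 'I_k) : glue_graph := glue_l (label K i).

Lemma glue_label_inj : injective glue_label.
Proof. by move=> i j [] /label_inj. Qed.

Definition glue : labelled loops k := Labelled glue_label_inj.

End Gluing.

Section Recognisability.
Variables (loops : bool) (k : nat) (FF : graph_class loops).

Definition rec_equiv (F1 F2 : labelled loops k) : Prop :=
  forall K : labelled loops k, FF (soe (glue K F1)) <-> FF (soe (glue K F2)).

(** [rep] is a system of representatives, one for each equivalence class, so
    there are exactly [C] classes. *)
Definition recognisability_index (C : nat) : Prop :=
  exists rep : 'I_C -> labelled loops k,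
    forall F : labelled loops k, exists! i : 'I_C, rec_equiv F (rep i).

End Recognisability.

Definition size_bound (n k C : nat) : nat :=
  maxn (k ^ (2 * C * n ^ k)) (2 * C * n ^ k).

(* Main.v *)
(** A graph [F] of treewidth at most [k - 1] with at least [k] vertices can be
    labelled so that it is built from [k]-vertex graphs by the operation
    [attach i A B], which glues [B] to [A] along all labels but the [i]-th.
    [attach] can be rearranged so that every graph on level [d + 1] arises from
    a [k]-vertex graph by attaching for each label at most one graph of level
    [d]; such a graph has at most [max (k ^ d) d] vertices.

    The numbers of homomorphisms to [G] and [H] with prescribed values on the
    labels form a vector of length [|G| ^ k + |H| ^ k], and [attach] is bilinear
    on these vectors and compatible with [rec_equiv].  Keep one span per
    equivalence class: the total dimension of the spans of levels
    [0, 1, ...] increases until it is stationary, which happens at some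
    [d <= C (|G| ^ k + |H| ^ k)], and from then on the spans stay the same.
    Hence the vector of any [F] in the class is a linear combination of vectors
    of graphs of level [d] equivalent to it, which also lie in the class, and the
    linear functional [hom(-, G) - hom(-, H)] vanishes on those. *)

From Stdlib Require Import Setoid Classical.
From mathcomp Require Import all_boot all_algebra.
Require Import Defs.

Set Implicit Arguments.
Unset Strict Implicit.
Unset Printing Implicit Defensive.

(** * Gluing and forgetting *)

Definition embedding (loops : bool) (F G : graph loops) (h : F -> G) : Prop :=
  injective h /\ forall u v, edge G (h u) (h v) = edge F u v.

Lemma embedding_isomorphic (loops : bool) (F G : graph loops) (h : F -> G) :
  embedding h -> (forall y, exists x, h x = y) -> isomorphic F G.
Proof.
move=> [h_inj h_edge] h_surj; exists h => //.
have ex y : exists x, h x == y by have [x <-] := h_surj y; exists x.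
by exists (fun y => xchoose (ex y)) => [x|y]; [apply: h_inj|]; exact/eqP/(xchooseP (ex _)).
Qed.

Lemma isomorphic_sym (loops : bool) (F G : graph loops) :
  isomorphic F G -> isomorphic G F.
Proof.
move=> [h [g hK gK] h_edge]; exists g => [|u v]; first by exists h.
by rewrite -h_edge !gK.
Qed.

Section Gluing.
Variables (loops : bool) (k : nat).
Implicit Types (K F A B : labelled loops k).

Lemma glue_l_inj K F : injective (@glue_l _ _ K F).
Proof. by move=> x y []. Qed.

Lemma glue_cover K F (z : soe (glue K F)) :
  (exists x, z = @glue_l _ _ K F x) \/ (exists y, z = @glue_r _ _ K F y).
Proof.
case: z => [x|[y hy]]; [by left; exists x | right; exists y].
rewrite /glue_r; case: {-}_ / boolP => h; first by have := hy; rewrite h.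
by congr inr; apply: val_inj.
Qed.

Lemma glue_overlap K F x y :
  @glue_l _ _ K F x = @glue_r _ _ K F y -> exists2 i, x = label K i & y = label F i.
Proof.
rewrite /glue_r; case: {-}_ / boolP => // h [->].
by exists (iinv h) => //; rewrite f_iinv.
Qed.

Lemma glue_edgeP K F (z z' : soe (glue K F)) :
  reflect
    ((exists x x', [/\ edge (soe K) x x', glue_l F x = z & glue_l F x' = z']) \/
     (exists y y', [/\ edge (soe F) y y', @glue_r _ _ K F y = z & @glue_r _ _ K F y' = z']))
    (edge (soe (glue K F)) z z').
Proof.
apply: (iffP orP) => -[].
- by case/existsP=> x /existsP[x' /and3P[? /eqP ? /eqP ?]]; left; exists x, x'.
- by case/existsP=> x /existsP[x' /and3P[? /eqP ? /eqP ?]]; right; exists x, x'.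
- case=> x [x' [exx <- <-]]; left; apply/existsP; exists x; apply/existsP; exists x'.
  by rewrite exx !eqxx.
- case=> x [x' [exx <- <-]]; right; apply/existsP; exists x; apply/existsP; exists x'.
  by rewrite exx !eqxx.
Qed.

Section Copairing.
Variables (K F : labelled loops k) (T : Type) (a : soe K -> T) (b : soe F -> T).
Hypothesis ab_label : forall i, a (label K i) = b (label F i).

(** The map that [a] and [b] induce on the gluing, seen as a pushout; merged vertices take their
    value from [a]. *)
Definition glue_map (z : soe (glue K F)) : T :=
  match z with inl x => a x | inr y => b (val y) end.

Lemma glue_map_l x : glue_map (glue_l F x) = a x.
Proof. by []. Qed.

Lemma glue_map_r y : glue_map (glue_r K y) = b y.
Proof.
rewrite /glue_r; case: {-}_ / boolP => //= h.
by rewrite ab_label f_iinv.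
Qed.

End Copairing.

(** The last hypothesis concerns only edges of [Z] within the image of [glue_map a b], so the lemma
    also recognises a gluing as a proper induced subgraph of [Z]. *)
Lemma glue_embedding K F (Z : graph loops) (a : soe K -> Z) (b : soe F -> Z) :
    injective a -> injective b ->
    (forall i, a (label K i) = b (label F i)) ->
    (forall x y, a x = b y -> exists2 i, x = label K i & y = label F i) ->
    (forall x x', edge (soe K) x x' -> edge Z (a x) (a x')) ->
    (forall y y', edge (soe F) y y' -> edge Z (b y) (b y')) ->
    (forall z z', edge Z (glue_map a b z) (glue_map a b z') ->
      (exists x x', [/\ edge (soe K) x x', a x = glue_map a b z & a x' = glue_map a b z']) \/
      (exists y y', [/\ edge (soe F) y y', b y = glue_map a b z & b y' = glue_map a b z'])) ->
  embedding (glue_map a b).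
Proof.
move=> a_inj b_inj ab_lab ab_cap a_edge b_edge ab_edge.
have map_inj : injective (glue_map a b).
  move=> z z'.
  case: (glue_cover z) => [[x ->]|[y ->]]; case: (glue_cover z') => [[x' ->]|[y' ->]];
    rewrite ?glue_map_l ?(glue_map_r ab_lab).
  - by move/a_inj->.
  - by case/ab_cap=> i -> ->; rewrite glue_r_label.
  - by move/esym/ab_cap=> [i -> ->]; rewrite glue_r_label.
  - by move/b_inj->.
split=> // z z'; apply/idP/glue_edgeP.
- case/ab_edge=> -[x [x' [exx ex ex']]]; [left|right]; exists x, x'; split=> //;
    by apply: map_inj; rewrite ?(glue_map_r ab_lab).
- by case=> -[x [x' [exx <- <-]]]; rewrite ?glue_map_l ?(glue_map_r ab_lab); auto.
Qed.

Lemma glue_isomorphic K F (Z : graph loops) (a : soe K -> Z) (b : soe F -> Z) :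
    injective a -> injective b ->
    (forall i, a (label K i) = b (label F i)) ->
    (forall x y, a x = b y -> exists2 i, x = label K i & y = label F i) ->
    (forall z, (exists x, z = a x) \/ (exists y, z = b y)) ->
    (forall x x', edge (soe K) x x' -> edge Z (a x) (a x')) ->
    (forall y y', edge (soe F) y y' -> edge Z (b y) (b y')) ->
    (forall z z', edge Z z z' ->
      (exists x x', [/\ edge (soe K) x x', a x = z & a x' = z']) \/
      (exists y y', [/\ edge (soe F) y y', b y = z & b y' = z'])) ->
  isomorphic (soe (glue K F)) Z.
Proof.
move=> a_inj b_inj ab_lab ab_cap ab_cover a_edge b_edge ab_edge.
apply: (@embedding_isomorphic _ _ _ (glue_map a b)).
  by apply: glue_embedding => // z z'; apply: ab_edge.
move=> z; case: (ab_cover z) => -[x ->].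
  by exists (glue_l F x).
by exists (glue_r K x); rewrite glue_map_r.
Qed.

Lemma glue_l_edge K F x x' :
  edge (soe K) x x' -> edge (soe (glue K F)) (glue_l F x) (glue_l F x').
Proof. by move=> e; apply/glue_edgeP; left; exists x, x'. Qed.

Lemma glue_r_edge K F y y' :
  edge (soe F) y y' -> edge (soe (glue K F)) (glue_r K y) (glue_r K y').
Proof. by move=> e; apply/glue_edgeP; right; exists y, y'. Qed.

Lemma glueC K F : isomorphic (soe (glue K F)) (soe (glue F K)).
Proof.
apply: (@glue_isomorphic K F (soe (glue F K)) (@glue_r _ _ F K) (@glue_l _ _ F K)).
- exact: glue_r_inj.
- exact: glue_l_inj.
- exact: glue_r_label.
- by move=> x y /esym/glue_overlap[i -> ->]; exists i.
- by move=> z; case: (glue_cover z); [right|left].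
- exact: glue_r_edge.
- exact: glue_l_edge.
- by move=> z z' /glue_edgeP[]; [right|left].
Qed.

(** The three graphs embed in the right-hand side and meet pairwise exactly in the labels, which
    also describes the left-hand side. *)
Lemma glueA K A B :
  isomorphic (soe (glue (glue K A) B)) (soe (glue K (glue A B))).
Proof.
pose Z := glue K (glue A B).
pose aK (x : soe K) : soe Z := glue_l (glue A B) x.
pose aA (y : soe A) : soe Z := glue_r K (glue_l B y : soe (glue A B)).
pose aB (y : soe B) : soe Z := glue_r K (glue_r A y : soe (glue A B)).
have KA i : aK (label K i) = aA (label A i).
  by rewrite /aA /aK -(glue_r_label K (glue A B)).
have AB i : aA (label A i) = aB (label B i) by rewrite /aB glue_r_label.
have aKA x y : aK x = aA y -> exists2 i, x = label K i & y = label A i.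
  by case/glue_overlap=> i -> /glue_l_inj; exists i.
have aKB x y : aK x = aB y -> exists2 i, x = label K i & y = label B i.
  by case/glue_overlap=> i -> /esym/glue_overlap[j /label_inj -> ->]; exists j.
have aAB x y : aA x = aB y -> exists2 i, x = label A i & y = label B i.
  by move/glue_r_inj/glue_overlap.
have aA_inj : injective aA by move=> x y /glue_r_inj/glue_l_inj.
have aB_inj : injective aB by move=> x y /glue_r_inj/glue_r_inj.
have KAr y : glue_map aK aA (glue_r K y) = aA y by apply: glue_map_r.
have aK_edge x x' : edge (soe K) x x' -> edge (soe Z) (aK x) (aK x') by apply: glue_l_edge.
have aA_edge x x' : edge (soe A) x x' -> edge (soe Z) (aA x) (aA x').
  by move=> e; apply/glue_r_edge/glue_l_edge.
have aB_edge x x' : edge (soe B) x x' -> edge (soe Z) (aB x) (aB x').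
  by move=> e; apply/glue_r_edge/glue_r_edge.
apply: (@glue_isomorphic _ _ _ (glue_map aK aA) aB) => //.
- move=> z z'.
  case: (glue_cover z) => -[x ->]; case: (glue_cover z') => -[x' ->]; rewrite ?KAr ?glue_map_l.
  + by move/glue_l_inj->.
  + by case/aKA=> i -> ->; rewrite glue_r_label.
  + by move/esym/aKA=> [i -> ->]; rewrite glue_r_label.
  + by move/aA_inj->.
- by move=> i; rewrite /= KA AB.
- move=> z y; case: (glue_cover z) => -[x ->]; rewrite ?KAr ?glue_map_l.
    by case/aKB=> i -> ->; exists i.
  by case/aAB=> i -> ->; exists i => //; rewrite glue_r_label.
- move=> z; case: (glue_cover z) => -[x ->]; first by left; exists (glue_l A x).
  case: (glue_cover x) => -[y ->]; last by right; exists y.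
  by left; exists (glue_r K y); rewrite KAr.
- by move=> z z' /glue_edgeP[] [x [x' [e <- <-]]]; rewrite ?KAr ?glue_map_l; auto.
- move=> z z' /glue_edgeP[] [x [x' [e <- <-]]].
    by left; exists (glue_l A x), (glue_l A x'); split=> //; apply: glue_l_edge.
  case/glue_edgeP: e => -[y [y' [e <- <-]]]; last by right; exists y, y'.
  by left; exists (glue_r K y), (glue_r K y'); rewrite !KAr; split=> //; apply: glue_r_edge.
Qed.

Section Forget.
Variables (i : 'I_k) (F : labelled loops k).

Definition forget_edge : rel (option (soe F)) := fun x y =>
  match x, y with Some u, Some v => edge (soe F) u v | _, _ => false end.

Lemma forget_edge_sym : symmetric forget_edge.
Proof. by move=> [u|] [v|] //=; apply: edge_sym. Qed.

Lemma forget_edge_irr : ~~ loops -> irreflexive forget_edge.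
Proof. by move=> nl [u|] //=; apply: edge_irr. Qed.

Definition forget_graph : graph loops := Graph forget_edge_sym forget_edge_irr.

Definition forget_label (j : 'I_k) : forget_graph :=
  if j == i then None else Some (label F j).

Lemma forget_label_inj : injective forget_label.
Proof.
move=> j j'; rewrite /forget_label.
by case: eqP => [->|_]; case: eqP => [->|_] // -[/label_inj].
Qed.

(** The [i]-th label moves from its vertex to a fresh isolated vertex. *)
Definition forget : labelled loops k := Labelled forget_label_inj.

End Forget.

(** Both sides merge [K] and [F] along all labels but the [i]-th: the fresh isolated vertex is
    absorbed by the [i]-th labelled vertex of the other graph. *)
Lemma forget_adjoint i K F :
  isomorphic (soe (glue K (forget i F))) (soe (glue (forget i K) F)).
Proof.
pose Z := glue (forget i K) F.
pose w : soe Z := glue_r (forget i K) (label F i).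
have wE : w = glue_l F (None : soe (forget i K)).
  by rewrite /w glue_r_label /= /forget_label eqxx.
have Sl j : j != i ->
    glue_l F (Some (label K j) : soe (forget i K)) = glue_r (forget i K) (label F j).
  by move=> ji; rewrite glue_r_label /= /forget_label (negPf ji).
pose a (x : soe K) : soe Z := glue_l F (Some x : soe (forget i K)).
pose b (y : soe (forget i F)) : soe Z :=
  if y is Some v then glue_r (forget i K) v else a (label K i).
have ab x v : a x = b (Some v) -> exists j, [/\ j != i, x = label K j & v = label F j].
  case/glue_overlap=> j /=; rewrite /forget_label; case: eqP => // /eqP ji [->] ->.
  by exists j.
apply: (@glue_isomorphic _ _ _ a b).
- by move=> x y /glue_l_inj [].
- move=> [u|] [v|] // e; first by rewrite (glue_r_inj e).
    by have [j [ji /label_inj ij _]] := ab _ _ (esym e); rewrite ij eqxx in ji.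
  by have [j [ji /label_inj ij _]] := ab _ _ e; rewrite ij eqxx in ji.
- move=> j /=; rewrite /forget_label; case: eqP => [->|/eqP ji] //=.
  exact: Sl.
- move=> x [v|]; last by move/glue_l_inj=> -[->]; exists i => //=; rewrite /forget_label eqxx.
  by case/ab=> j [ji -> ->]; exists j => //=; rewrite /forget_label (negPf ji).
- move=> z; case: (glue_cover z) => -[x ->]; last by right; exists (Some x).
  case: x => [x|]; first by left; exists x.
  by right; exists (Some (label F i)); rewrite -wE.
- by move=> x x' e; apply: glue_l_edge.
- by move=> [u|] [v|] //= e; apply: glue_r_edge.
- move=> z z' /glue_edgeP[] [x [x' [e <- <-]]]; last by right; exists (Some x), (Some x').
  by case: x x' e => [x|] [x'|] //= e; left; exists x, x'.
Qed.

(** The unit of gluing. As the context in [rec_equiv] it shows that of two equivalent graphs both or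
    neither lie in the class. *)
Definition edgeless : labelled loops k :=
  @Labelled loops k
    (@Graph loops 'I_k (fun _ _ => false) (fun _ _ => erefl) (fun _ _ => erefl))
    id (fun _ _ => id).

Lemma edgeless_glue F : isomorphic (soe (glue edgeless F)) (soe F).
Proof.
apply: (@glue_isomorphic _ _ _ (label F : soe edgeless -> soe F) id) => //.
- exact: label_inj.
- by move=> x y <-; exists x.
- by move=> z; right; exists z.
- by move=> z z' e; right; exists z, z'.
Qed.

End Gluing.

(** * Recognisability is compatible with attaching *)

Section RecEquiv.
Variables (loops : bool) (k : nat) (FF : graph_class loops).
Hypothesis FF_iso : iso_closed FF.
Implicit Types (K F A B : labelled loops k).

Lemma iso_class (F G : graph loops) : isomorphic F G -> FF F <-> FF G.
Proof. by move=> FG; split; apply: FF_iso => //; apply: isomorphic_sym. Qed.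

Lemma rec_equiv_trans F1 F2 F3 :
  rec_equiv FF F1 F2 -> rec_equiv FF F2 F3 -> rec_equiv FF F1 F3.
Proof. by move=> h12 h23 K; apply: iff_trans (h12 K) (h23 K). Qed.

Lemma rec_equiv_sym F1 F2 : rec_equiv FF F1 F2 -> rec_equiv FF F2 F1.
Proof. by move=> h K; apply: iff_sym (h K). Qed.

Definition attach (i : 'I_k) A B : labelled loops k := glue A (forget i B).

(** The next two equivalences move everything but one argument of [attach]
    into the context [K] over which [rec_equiv] quantifies. *)
Lemma attach_class_r i K A B :
  FF (soe (glue K (attach i A B))) <-> FF (soe (glue (forget i (glue K A)) B)).
Proof.
by rewrite -(iso_class (glueA _ _ _)) (iso_class (forget_adjoint _ _ _)).
Qed.

Lemma attach_class_l i K A B :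
  FF (soe (glue K (attach i A B))) <-> FF (soe (glue (glue (forget i B) K) A)).
Proof.
rewrite (iso_class (glueC K _)) (iso_class (glueA A _ K)).
exact: iso_class (glueC A _).
Qed.

Lemma rec_equiv_attach i A A' B B' :
    rec_equiv FF A A' -> rec_equiv FF B B' ->
  rec_equiv FF (attach i A B) (attach i A' B').
Proof.
move=> AA' BB' K; rewrite attach_class_r (BB' _) -attach_class_r.
by rewrite attach_class_l (AA' _) -attach_class_l.
Qed.

End RecEquiv.

(** * Homomorphism counts *)

Lemma is_homP (loops : bool) (F G : graph loops) (h : {ffun F -> G}) :
  reflect (forall u v, edge F u v -> edge G (h u) (h v)) (is_hom h).
Proof.
by apply: (iffP forallP) => hh u; [move=> v; apply/implyP/(forallP (hh u))
  | apply/forallP=> v; apply/implyP/hh].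
Qed.

Lemma hom_iso (loops : bool) (F F' G : graph loops) :
  isomorphic F F' -> hom F G = hom F' G.
Proof.
move=> [f [g fK gK] f_edge]; rewrite /hom -!sum1_card.
pose pull (h : {ffun F' -> G}) := [ffun u => h (f u)].
pose push (h : {ffun F -> G}) := [ffun u => h (g u)].
have pushK h : pull (push h) = h by apply/ffunP=> u; rewrite !ffunE fK.
have pullK h : push (pull h) = h by apply/ffunP=> u; rewrite !ffunE gK.
rewrite (reindex_onto pull push) => [|h _]; last exact: pushK.
apply: eq_bigl => h; rewrite pullK eqxx andbT !inE.
apply/is_homP/is_homP=> hh u v uv.
  by have := hh (g u) (g v); rewrite -f_edge !ffunE !gK; apply.
by rewrite !ffunE; apply: hh; rewrite f_edge.
Qed.

Section PinnedHoms.
Variables (loops : bool) (k : nat) (G : graph loops).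
Implicit Types (A B F : labelled loops k) (phi : {ffun 'I_k -> G}).

Definition pinned F phi (h : {ffun soe F -> G}) : bool :=
  is_hom h && [forall i, h (label F i) == phi i].

Lemma pinnedP F phi (h : {ffun soe F -> G}) :
  reflect ((forall u v, edge (soe F) u v -> edge G (h u) (h v)) /\
           forall i, h (label F i) = phi i)
          (pinned phi h).
Proof.
apply: (iffP andP) => -[hh lh]; split; try exact/is_homP.
  by move=> i; apply/eqP/(forallP lh).
by apply/forallP=> i; apply/eqP.
Qed.

Definition pinned_hom F phi : nat := \sum_(h : {ffun soe F -> G} | pinned phi h) 1.

Lemma hom_pinned F : hom (soe F) G = \sum_phi pinned_hom F phi.
Proof.
rewrite /hom -sum1_card.
rewrite (partition_big (fun h : {ffun soe F -> G} => [ffun i => h (label F i)]) xpredT) //=.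
apply: eq_bigr => phi _; apply: eq_bigl => h; rewrite /pinned; congr (_ && _).
apply/eqP/forallP => [<- i|e]; first by rewrite ffunE.
by apply/ffunP=> i; rewrite ffunE; apply/eqP.
Qed.

(** A homomorphism from the gluing is a pair of homomorphisms that agree on the labels, as every
    edge of the gluing comes from one of the two parts. *)
Lemma pinned_hom_glue A B phi :
  pinned_hom (glue A B) phi = pinned_hom A phi * pinned_hom B phi.
Proof.
rewrite /pinned_hom big_distrlr /= pair_big /=.
pose join (p : {ffun soe A -> G} * {ffun soe B -> G}) : {ffun soe (glue A B) -> G} :=
  [ffun z => glue_map p.1 p.2 z].
pose split (h : {ffun soe (glue A B) -> G}) :=
  ([ffun x => h (glue_l B x)], [ffun y => h (glue_r A y)]).
rewrite (reindex_onto join split) /=; last first.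
  move=> h _; apply/ffunP=> z; rewrite ffunE /split /=.
  have lab i : [ffun x => h (glue_l B x)] (label A i) = [ffun y => h (glue_r A y)] (label B i).
    by rewrite !ffunE glue_r_label.
  by case: (glue_cover z) => -[x ->]; rewrite ?glue_map_l ?(glue_map_r lab) ffunE.
apply: eq_bigl => -[h1 h2] /=; apply/andP/andP=> [[/pinnedP[hh hl] /eqP e]|].
  have e1 x : h1 x = join (h1, h2) (glue_l B x).
    by have /= /ffunP/(_ x) <- := congr1 fst e; rewrite ffunE.
  have e2 y : h2 y = join (h1, h2) (glue_r A y).
    by have /= /ffunP/(_ y) <- := congr1 snd e; rewrite ffunE.
  split; apply/pinnedP; split=> [u v uv|i].
  - by rewrite !e1; apply/hh/glue_l_edge.
  - by rewrite e1 -hl.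
  - by rewrite !e2; apply/hh/glue_r_edge.
  - by rewrite e2 glue_r_label -hl.
case=> /pinnedP[hh1 hl1] /pinnedP[hh2 hl2].
have lab i : h1 (label A i) = h2 (label B i) by rewrite hl1 hl2.
have e1 x : join (h1, h2) (glue_l B x) = h1 x by rewrite ffunE.
have e2 y : join (h1, h2) (glue_r A y) = h2 y by rewrite ffunE (glue_map_r lab).
split; last by apply/eqP; congr pair; apply/ffunP=> x; rewrite ffunE ?e1 ?e2.
apply/pinnedP; split=> [z z' /glue_edgeP[] [x [x' [exx <- <-]]]|i].
- by rewrite !e1; apply: hh1.
- by rewrite !e2; apply: hh2.
- by rewrite /= /glue_label e1.
Qed.

Definition relabel i phi (x : G) : {ffun 'I_k -> G} :=
  [ffun j => if j == i then x else phi j].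

(** The fresh vertex is isolated and its image is prescribed; the vertex that loses the label [i]
    may go anywhere, and [x] is its image. *)
Lemma pinned_hom_forget i B phi :
  pinned_hom (forget i B) phi = \sum_x pinned_hom B (relabel i phi x).
Proof.
rewrite /pinned_hom (partition_big
  (fun h : {ffun soe (forget i B) -> G} => h (Some (label B i))) xpredT) //=.
apply: eq_bigr => x _.
pose ext (h : {ffun soe B -> G}) : {ffun soe (forget i B) -> G} :=
  [ffun y : option (soe B) => if y is Some v then h v else phi i].
pose res (h : {ffun soe (forget i B) -> G}) : {ffun soe B -> G} :=
  [ffun y => h (Some y)].
have extK h : res (ext h) = h by apply/ffunP=> v; rewrite !ffunE.
rewrite (reindex_onto ext res) /=; last first.
  move=> h /andP[/pinnedP[_ hl] _]; apply/ffunP=> -[v|]; rewrite !ffunE //.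
  by have := hl i; rewrite /= /forget_label eqxx.
apply: eq_bigl => h; rewrite extK eqxx andbT ffunE.
apply/andP/pinnedP=> [[/pinnedP[hh hl] /eqP hx]|[hh hl]].
  split=> [u v uv|j]; first by have := hh (Some u) (Some v) uv; rewrite !ffunE.
  rewrite ffunE; case: eqP => [->//|/eqP ji].
  by have := hl j; rewrite /= /forget_label (negPf ji) ffunE.
split; last by rewrite hl ffunE eqxx.
apply/pinnedP; split=> [[u|] [v|] //= uv|j]; first by rewrite !ffunE; apply: hh.
rewrite /= /forget_label; case: (eqVneq j i) => [->|ji]; rewrite ffunE //.
by rewrite hl ffunE (negPf ji).
Qed.

Lemma pinned_hom_attach i A B phi :
  pinned_hom (attach i A B) phi =
  pinned_hom A phi * \sum_x pinned_hom B (relabel i phi x).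
Proof. by rewrite pinned_hom_glue pinned_hom_forget. Qed.

End PinnedHoms.

(** * Linear spans *)

Section LinearSpan.
Import GRing.Theory.
Local Open Scope ring_scope.

(** [P] may be any predicate, such as being the vector of some graph of a level, and is not given by
    a finite list. *)
Inductive lspan (K : pzRingType) (V : lmodType K) (P : V -> Prop) : V -> Prop :=
  | lspan0 : lspan P 0
  | lspanD a u v : P u -> lspan P v -> lspan P (a *: u + v).

Section Lspan.
Variables (K : pzRingType) (V : lmodType K).
Implicit Types (P : V -> Prop).

Lemma lspan_mem P u : P u -> lspan P u.
Proof. by move=> Pu; rewrite -[u]addr0 -{1}[u]scale1r; apply/lspanD/lspan0. Qed.

Lemma lspan_add P u v : lspan P u -> lspan P v -> lspan P (u + v).
Proof.
elim=> [|a w u' Pw _ IH] Pv; first by rewrite add0r.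
by rewrite -addrA; apply/lspanD/IH.
Qed.

Lemma lspan_scale P a u : lspan P u -> lspan P (a *: u).
Proof.
elim=> [|b w v Pw _ IH]; first by rewrite scaler0; apply: lspan0.
by rewrite scalerDr scalerA; apply: lspanD.
Qed.

End Lspan.

Lemma lspan_linear (K : pzRingType) (V W : lmodType K) (f : V -> W)
    (P : V -> Prop) (Q : W -> Prop) u :
    linear f -> (forall w, P w -> lspan Q (f w)) -> lspan P u -> lspan Q (f u).
Proof.
move=> f_lin PQ.
have f0 : f 0 = 0.
  by have := f_lin (-1) 0 0; rewrite scaler0 addr0 scaleN1r addNr.
elim=> [|a w v Pw _ IH]; first by rewrite f0; apply: lspan0.
by rewrite f_lin; apply: (lspan_add _ IH); apply/lspan_scale/PQ.
Qed.

Lemma lspan_sub (K : pzRingType) (V : lmodType K) (P Q : V -> Prop) u :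
  (forall w, P w -> lspan Q w) -> lspan P u -> lspan Q u.
Proof. exact: (@lspan_linear _ V V id). Qed.

Section Chain.
Variables (K : fieldType) (V : vectType K).

Lemma span_lspan (P : V -> Prop) (s : seq V) (v : V) :
  (forall u, u \in s -> P u) -> v \in <<s>>%VS -> lspan P v.
Proof.
move=> sP; rewrite -[s]/(tval (in_tuple s)) => /coord_span ->.
apply: (big_ind (lspan P)) => [|u w|i _]; [exact: lspan0 | exact: lspan_add |].
by apply/lspan_scale/lspan_mem/sP/mem_nth.
Qed.

(** Otherwise every step up to the dimension would contribute a vector independent of those chosen
    before, giving a free family of more than [\dim {:V}] vectors. *)
Lemma lspan_chain_stable (P : nat -> V -> Prop) :
    (forall d u, P d u -> P d.+1 u) ->
  exists2 d, (d <= \dim {:V})%N & forall u, P d.+1 u -> lspan (P d) u.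
Proof.
move=> P_mono; apply: NNPP => no_stable.
have grow d : (d <= (\dim {:V}).+1)%N ->
    exists s : seq V, [/\ free s, size s = d & forall u, u \in s -> P d u].
  elim: d => [_|d IH d_le]; first by exists [::]; split; rewrite ?nil_free.
  have [s [s_free s_size sP]] := IH (ltnW d_le).
  (* If [s] had no free extension in [P d.+1], all of [P d.+1] would lie in the span of [s], and [d]
     would be stable. *)
  apply: NNPP => no_s; case: no_stable; exists d => // v Pv.
  apply: (span_lspan sP); apply/negPn/negP => v_s; case: no_s; exists (v :: s).
  split; rewrite ?free_cons ?v_s ?s_free //=; first by rewrite s_size.
  by move=> u; rewrite in_cons => /orP[/eqP ->|/sP /P_mono].
have [s [/eqP s_free s_size _]] := grow _ (leqnn _).
by have := dimvS (subvf <<s>>%VS); rewrite s_free s_size ltnn.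
Qed.

End Chain.

End LinearSpan.

(** * Levels *)

Lemma level_bound0 k : 0 < k -> k + k * (1 - k) <= maxn (k ^ 1) 1.
Proof. by move=> k_gt0; rewrite (eqP k_gt0) muln0 addn0 expn1 leq_maxl. Qed.

(** For [k >= 2] the bound is [c = k ^ d.+1], and [k + k * (c + 1 - k) = k * (c + 2 - k) <= k * c].
    For [k = 1] the size grows by one per level, which is why a maximum is taken. *)
Lemma level_boundS k d : 0 < k ->
  k + k * ((maxn (k ^ d.+1) d.+1).+1 - k) <= maxn (k ^ d.+2) d.+2.
Proof.
case: k => [|[|k]] // _.
  by rewrite !exp1n mul1n subSS subn0 add1n leq_max; apply/orP; right; rewrite ltnS (maxn_idPr _).
set K := k.+2; have -> : maxn (K ^ d.+1) d.+1 = K ^ d.+1.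
  by apply/maxn_idPl/ltnW/ltn_expl.
apply: leq_trans (leq_maxl _ _).
rewrite -{1}[K]muln1 -mulnDr [_ ^ d.+2]expnS leq_mul2l; apply/orP; right.
have Kd : K <= (K ^ d.+1).+1 by rewrite expnS ltnW // ltnS leq_pmulr // expn_gt0.
by rewrite addnBA // leq_subLR add1n -addn2 addnC leq_add2r.
Qed.

Section Levels.
Variables (loops : bool) (k : nat).
Implicit Types (L A B : labelled loops k) (P Q : labelled loops k -> Prop).

Fixpoint stage P (s : seq 'I_k) L : Prop :=
  match s with
  | [::] => #|soe L| = k
  | i :: s' => stage P s' L \/
      exists A B, [/\ stage P s' A, P B & L = attach i A B]
  end.

(** Level 0 is empty, so nothing can be attached on level 1, which consists of the graphs whose
    vertices are exactly the [k] labels. *)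
Fixpoint level (d : nat) : labelled loops k -> Prop :=
  if d is d'.+1 then stage (level d') (enum 'I_k) else fun _ => False.

Lemma stage_mono P Q s L : (forall B, P B -> Q B) -> stage P s L -> stage Q s L.
Proof.
move=> PQ; elim: s L => [|i s IH] L //= [/IH|[A [B [/IH sA /PQ QB ->]]]]; first by left.
by right; exists A, B.
Qed.

Lemma level_monoS d L : level d L -> level d.+1 L.
Proof. by elim: d L => [|d IH] L //; apply: stage_mono. Qed.

Lemma label_card L : k <= #|soe L|.
Proof. by rewrite -[k in k <= _]card_ord; apply/leq_card/label_inj. Qed.

(** [forget i B] has one vertex more than [B], and then [k] vertices are merged. *)
Lemma attach_card i A B : #|soe (attach i A B)| + k = (#|soe A| + #|soe B|).+1.
Proof.
set F := forget i B.
have cF : #|codom (label F)| = k by rewrite card_codom ?card_ord //; apply: label_inj.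
have := cardC (mem (codom (label F))); rewrite cF [RHS]card_option -addnS => <-.
by rewrite card_sum card_sig -addnA [_ + k]addnC.
Qed.

(** Each attachment merges all but one of the labels of the attached graph and so adds at most
    [b.+1 - k] vertices. *)
Lemma stage_card P s L b :
  (forall B, P B -> #|soe B| <= b) -> stage P s L -> #|soe L| <= k + size s * (b.+1 - k).
Proof.
move=> Pb; elim: s L => [|i s IH] L /=; first by move->; rewrite addn0.
case=> [/IH /leq_trans|[A [B [/IH sA /Pb Bb ->]]]].
  by apply; rewrite leq_add2l leq_mul2r leqnSn orbT.
rewrite -(leq_add2r k) attach_card -addnS mulSn.
have kb : k <= b.+1 by apply: leq_trans (label_card B) (leq_trans Bb _).
rewrite [_ + _ * _ as X in _ + X]addnC addnA -addnA subnK //.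
by apply: leq_add.
Qed.

Lemma level_card d L : 0 < k -> level d L -> #|soe L| <= maxn (k ^ d) d.
Proof.
move=> k_gt0 dL; case: d L dL => // d L dL.
have step b c : (forall B, level b B -> #|soe B| <= c) ->
    forall A, level b.+1 A -> #|soe A| <= k + k * (c.+1 - k).
  by move=> bc A /(stage_card bc); rewrite size_enum_ord.
elim: d L dL => [|d IH] L.
  (* The empty level 0 satisfies the bound 0. *)
  by move/(@step 0 0)/leq_trans; apply=> //; apply: level_bound0.
by move/(step _ _ IH)/leq_trans; apply; apply: level_boundS.
Qed.

End Levels.

(** * Spans of homomorphism vectors within the equivalence classes *)

Section HomVectors.
Import GRing.Theory.
Local Open Scope ring_scope.
Variables (loops : bool) (k C : nat) (FF : graph_class loops).
Hypothesis FF_iso : iso_closed FF.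
Variable rep : 'I_C -> labelled loops k.
Hypothesis rep_unique : forall F, exists! c, rec_equiv FF F (rep c).
Variables G H : graph loops.
Implicit Types (L A B : labelled loops k) (P Q : labelled loops k -> Prop) (c : 'I_C).

Let X : finType := ({ffun 'I_k -> G} + {ffun 'I_k -> H})%type.
Let W := {ffun X -> rat^o}.

Definition hom_vec L : W := [ffun x : X =>
  match x return nat with
  | inl phi => pinned_hom L phi
  | inr psi => pinned_hom L psi
  end%:R].

(** The bilinear operation that [attach i] induces on count vectors; the sums run over the image of
    the vertex of the attached graph that loses its label. *)
Definition attach_vec (i : 'I_k) (u w : W) : W := [ffun x : X =>
  u x * match x return rat with
        | inl phi => \sum_g w (inl (relabel i phi g))
        | inr psi => \sum_h w (inr (relabel i psi h))
        end].

Lemma hom_vec_attach i A B :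
  hom_vec (attach i A B) = attach_vec i (hom_vec A) (hom_vec B).
Proof.
apply/ffunP=> -[phi|psi]; rewrite !ffunE pinned_hom_attach natrM natr_sum;
  by congr (_ * _); apply: eq_bigr => x _; rewrite ffunE.
Qed.

Let scaleE (a b : rat) : a *: (b : rat^o) = a * b.
Proof. by []. Qed.

Lemma attach_vec_linear_l i w : linear (attach_vec i ^~ w).
Proof. by move=> a u v; apply/ffunP=> x; rewrite !ffunE !scaleE mulrDl mulrA. Qed.

Lemma attach_vec_linear_r i u : linear (attach_vec i u).
Proof.
move=> a v w; apply/ffunP=> -[x|x]; rewrite !ffunE !scaleE mulrCA -mulrDr;
  congr (_ * _); rewrite mulr_sumr -big_split /=; apply: eq_bigr => y _;
  by rewrite !ffunE scaleE.
Qed.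

Definition hom_vecs P c (u : W) : Prop :=
  exists L, [/\ P L, rec_equiv FF L (rep c) & u = hom_vec L].

(** By bilinearity, the vectors of [A] and [B] can be expanded in vectors of graphs equivalent to
    them; attaching those instead yields graphs still equivalent to the original one. *)
Lemma stage_span P Q s :
    (forall B c, P B -> rec_equiv FF B (rep c) -> lspan (hom_vecs Q c) (hom_vec B)) ->
  forall A c, stage P s A -> rec_equiv FF A (rep c) ->
    lspan (hom_vecs (stage Q s) c) (hom_vec A).
Proof.
move=> PQ; elim: s => [|i s IH] L c.
  by move=> sL Lc; apply: lspan_mem; exists L.
case=> [sL /(IH _ _ sL)|[A [B [sA PB ->]]]] Lc.
  by apply: lspan_sub Lc => w [L' [sL' ? ?]]; apply: lspan_mem; exists L'; split=> //; left.
have [cA [AcA _]] := rep_unique A; have [cB [BcB _]] := rep_unique B.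
rewrite hom_vec_attach.
apply: (lspan_linear (attach_vec_linear_l i _)) (IH _ _ sA AcA) => _ [A' [sA' A'cA ->]].
apply: (lspan_linear (attach_vec_linear_r i _)) (PQ _ _ PB BcB) => _ [B' [QB' B'cB ->]].
apply: lspan_mem; exists (attach i A' B'); split; last by rewrite hom_vec_attach.
  by right; exists A', B'.
apply: rec_equiv_trans Lc; apply: rec_equiv_attach => //.
- by apply: rec_equiv_trans A'cA _; apply: rec_equiv_sym.
- by apply: rec_equiv_trans B'cB _; apply: rec_equiv_sym.
Qed.

(** The direct sum of one copy of [W] per equivalence class. Its dimension [C * #|X|] bounds the sum
    of the dimensions of all spans. *)
Let V := {ffun 'I_C * X -> rat^o}.

Definition in_class c (w : W) : V := [ffun p => if p.1 == c then w p.2 else 0].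
Definition of_class c (v : V) : W := [ffun x => v (c, x)].

Lemma of_class_linear c : linear (of_class c).
Proof. by move=> a u v; apply/ffunP=> x; rewrite !ffunE. Qed.

(** Collecting the vectors of all classes in one chain in [V] gives a [d] that serves every class at
    once. *)
Lemma levels_stable : exists2 d, (d <= C * #|X|)%N &
  forall L c, level d.+1 L -> rec_equiv FF L (rep c) ->
    lspan (hom_vecs (level d) c) (hom_vec L).
Proof.
pose P d (v : V) := exists c, exists2 w, hom_vecs (level d) c w & v = in_class c w.
have [d u [c [w [L [dL Lc ->]] ->]]|d d_le stable] := @lspan_chain_stable _ V P.
  by exists c, (hom_vec L) => //; exists L; split=> //; apply: level_monoS.
exists d.
  by rewrite (leq_trans d_le) // dimvf /dim /= card_prod card_ord muln1.
move=> L c dL Lc.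
have -> : hom_vec L = of_class c (in_class c (hom_vec L)).
  by apply/ffunP=> x; rewrite !ffunE eqxx.
(* The projection to the copy of class [c] recovers its own vectors and kills those of the other
   classes. *)
apply: (lspan_linear (of_class_linear c)) (stable _ _); last first.
  by exists c, (hom_vec L) => //; exists L.
move=> _ [c' [w w_vec ->]]; case: (eqVneq c c') => [<-|cc'] in w_vec *.
  apply: lspan_mem; suff -> : of_class c (in_class c w) = w by [].
  by apply/ffunP=> x; rewrite !ffunE eqxx.
suff -> : of_class c (in_class c' w) = 0 by apply: lspan0.
by apply/ffunP=> x; rewrite !ffunE (negPf cc').
Qed.

(** Stability at one step persists: if level [e] is spanned by level [d], then level [e.+1] is
    spanned by level [d.+1], hence by level [d]. *)
Lemma level_span d :
    (forall L c, level d.+1 L -> rec_equiv FF L (rep c) ->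
      lspan (hom_vecs (level d) c) (hom_vec L)) ->
  forall e L c, level e L -> rec_equiv FF L (rep c) ->
    lspan (hom_vecs (level d) c) (hom_vec L).
Proof.
move=> stable; elim=> // e IH L c eL Lc.
have := stage_span (fun B c' => IH B c') eL Lc.
by apply: lspan_sub => w [L' [dL' L'c ->]]; apply: stable.
Qed.

Definition hom_diff (w : W) : rat^o :=
  \sum_phi w (inl phi) - \sum_psi w (inr psi).

Lemma hom_diff_linear : linear hom_diff.
Proof.
move=> a u v; rewrite /hom_diff scalerBr !scaler_sumr addrACA -opprD -!big_split /=.
by congr (_ - _); apply: eq_bigr => x _; rewrite !ffunE.
Qed.

Lemma hom_diff_vec L :
  hom_diff (hom_vec L) = (hom (soe L) G)%:R - (hom (soe L) H)%:R :> rat.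
Proof.
rewrite /hom_diff !hom_pinned !natr_sum.
by congr (_ - _); apply: eq_bigr => x _; rewrite ffunE.
Qed.

Lemma hom_diff_eq0 L : hom_diff (hom_vec L) = 0 <-> hom (soe L) G = hom (soe L) H.
Proof.
rewrite hom_diff_vec; split=> [/eqP|->]; last by rewrite subrr.
by rewrite subr_eq0 Num.Theory.eqr_nat => /eqP.
Qed.

Lemma level_hom_eq : exists2 d, (d <= C * #|X|)%N &
  (forall L, level d L -> FF (soe L) -> hom (soe L) G = hom (soe L) H) ->
  forall e L, level e L -> FF (soe L) -> hom (soe L) G = hom (soe L) H.
Proof.
have [d d_le stable] := levels_stable; exists d => // d_eq e L eL FL.
have [c [Lc _]] := rep_unique L.
(* The span of zero is zero; in this form the vanishing of a linear functional is an instance of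
   [lspan_linear]. *)
suff zero : lspan (fun x : rat^o => x = 0) (hom_diff (hom_vec L)).
  apply/hom_diff_eq0; elim: zero => // a u v -> _ ->.
  by rewrite scaler0 addr0.
apply: (lspan_linear hom_diff_linear) (level_span stable eL Lc) => _ [L' [dL' L'c ->]].
apply: lspan_mem; apply/hom_diff_eq0; apply: d_eq => //.
(* Membership passes from [L] to the equivalent [L'] through the context [edgeless]. *)
apply: (FF_iso (edgeless_glue L')).
apply/L'c/Lc; apply: FF_iso FL; apply/isomorphic_sym/edgeless_glue.
Qed.

End HomVectors.

(** * Tree decompositions *)

Section Pieces.
Variables (loops : bool) (k : nat) (F : graph loops).
Implicit Types (q : 'I_k -> F) (A B X : {set F}) (P Q : ('I_k -> F) -> {set F} -> Prop).

(** Graphs built by [attach] are represented by vertex sets of a fixed graph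
    [F], so that rearranging the construction is a matter of equalities of sets
    and not of isomorphisms: if [A] and [B] carry the labels [q] and [q'], this
    says that [F[A :|: B]] is [attach i F[A] F[B]]. *)
Definition attachable i q A q' B : Prop :=
  [/\ forall j, j != i -> q' j = q j,
      forall x, x \in A -> x \in B -> exists2 j, j != i & x = q j &
      forall x y, x \in A -> x \notin B -> y \in B -> y \notin A -> ~~ edge F x y].

(** A set carries the edges that [F] induces on it, so a base piece is just the set of its [k]
    labels. *)
Inductive pieced : ('I_k -> F) -> {set F} -> Prop :=
  | pieced_base q : injective q -> pieced q (q @: setT)
  | pieced_attach i q A q' B :
      pieced q A -> pieced q' B -> attachable i q A q' B -> pieced q (A :|: B).

Lemma pieced_mem q A j : pieced q A -> q j \in A.
Proof.
move=> qA; elim: qA j => [q0 _ j|i q0 A0 q' B _ IH _ _ _ j]; first exact: imset_f.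
by rewrite in_setU IH.
Qed.

Lemma pieced_inj q A : pieced q A -> injective q.
Proof. by elim. Qed.

(** Gluing along all labels reduces to attaching: the pieces from which [B] is built are attached to
    [A] one after another, starting from the labels that [A] already contains. *)
Lemma pieced_union q A B :
    pieced q A -> pieced q B ->
    (forall x, x \in A -> x \in B -> exists j, x = q j) ->
    (forall x y, x \in A -> x \notin B -> y \in B -> y \notin A -> ~~ edge F x y) ->
  pieced q (A :|: B).
Proof.
move=> qA qB; elim: qB A qA => {q B} [q q_inj A qA _ _|].
  by rewrite (setUidPl _) //; apply/subsetP=> _ /imsetP[j _ ->]; apply: pieced_mem.
move=> i q B q' B' qB IH qB' _ [off cap sep] A qA capA sepA.
rewrite setUA; apply: (@pieced_attach i q (A :|: B) q' B') => //.
  apply: IH => // [x xA xB|x y xA xB yB yA].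
    by apply: capA; rewrite // in_setU xB.
  case: (boolP (x \in B')) => xB'; last by apply: sepA; rewrite // in_setU ?negb_or ?xB ?yB.
  have [j xj] : exists j, x = q j by apply: capA; rewrite // in_setU xB' orbT.
  by case/negP: xB; rewrite xj; apply: pieced_mem.
split=> // [x|x y].
  rewrite in_setU => /orP[xA|xB] xB'; last exact: cap.
  have [j xj] : exists j, x = q j by apply: capA; rewrite // in_setU xB' orbT.
  by apply: cap => //; rewrite xj; apply: pieced_mem.
rewrite !in_setU !negb_or => /orP[xA|xB] xB' yB' /andP[yA yB]; last exact: sep.
case: (boolP (x \in B)) => xB; first exact: sep.
by apply: sepA => //; rewrite in_setU ?negb_or ?xB ?yB' ?orbT.
Qed.

Fixpoint piece_stage P (s : seq 'I_k) q X : Prop :=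
  match s with
  | [::] => injective q /\ X = q @: setT
  | i :: s' => piece_stage P s' q X \/
      exists A q' B, [/\ piece_stage P s' q A, P q' B, attachable i q A q' B & X = A :|: B]
  end.

Fixpoint piece_level (d : nat) : ('I_k -> F) -> {set F} -> Prop :=
  if d is d'.+1 then piece_stage (piece_level d') (enum 'I_k) else fun _ _ => False.

Lemma piece_stage_mono P Q s q X :
  (forall q' B, P q' B -> Q q' B) -> piece_stage P s q X -> piece_stage Q s q X.
Proof.
move=> PQ; elim: s q X => [|i s IH] q X //= [/IH|[A [q' [B [/IH sA /PQ QB att ->]]]]].
  by left.
by right; exists A, q', B.
Qed.

Lemma piece_level_mono d d' q X : d <= d' -> piece_level d q X -> piece_level d' q X.
Proof.
move=> /subnK<-; elim: (d' - d) => // n IH /IH {IH}; rewrite addSn.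
elim: (n + d) q X => [|m IH] q X //; exact: piece_stage_mono.
Qed.

Lemma piece_stage_pieced P s q X :
  (forall q' B, P q' B -> pieced q' B) -> piece_stage P s q X -> pieced q X.
Proof.
move=> Pp; elim: s q X => [|i s IH] q X /=.
  by case=> q_inj ->; apply: pieced_base.
by case=> [/IH//|[A [q' [B [/IH sA /Pp QB att ->]]]]]; apply: pieced_attach att.
Qed.

Lemma piece_level_pieced d q X : piece_level d q X -> pieced q X.
Proof. by elim: d q X => [|d IH] q X //; apply: piece_stage_pieced. Qed.

(** If label [i] already carries a piece [B1], then [B] is attached to [B1]
    instead, which is possible because [B] meets [B1] only in the labels other
    than [i] ([Patt]). *)
Lemma piece_stage_attach P s i q A q' B :
    (forall q1 B1, P q1 B1 -> pieced q1 B1) ->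
    (forall q1 B1, P q1 B1 -> attachable i q1 B1 q' B ->
       exists d, piece_level d q1 (B1 :|: B)) ->
    (exists d, piece_level d q' B) ->
    (exists d, forall q1 B1, P q1 B1 -> piece_level d q1 B1) ->
    i \in s -> piece_stage P s q A -> attachable i q A q' B ->
  exists d, piece_stage (piece_level d) s q (A :|: B).
Proof.
move=> Pp Patt [dB qB] [dP Pd].
have up P' d1 d2 s1 q1 X1 : (forall q2 B2, P' q2 B2 -> piece_level d1 q2 B2) ->
    piece_stage P' s1 q1 X1 -> piece_stage (piece_level (d1 + d2)) s1 q1 X1.
  move=> h; apply: piece_stage_mono => q2 B2 /h; apply: piece_level_mono.
  exact: leq_addr.
elim: s q A => // j s IH q A.
rewrite in_cons; case: (eqVneq i j) => [<- _|ij /= i_s].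
- case=> [sA att|[A0 [q1 [B1 [sA0 PB1 [off1 cap1 sep1] ->]]]] [off cap sep]].
    exists (dP + dB); right; exists A, q', B; split=> //; first exact: up sA.
    by apply: piece_level_mono qB; apply: leq_addl.
  have att1 : attachable i q1 B1 q' B.
    split=> [l li|x xB1 xB|x y xB1 xB yB yB1].
    - by rewrite off // off1.
    - have [l li ->] : exists2 l, l != i & x = q l by apply: cap; rewrite // in_setU xB1 orbT.
      by exists l; rewrite ?off1.
    - apply: sep; rewrite // ?in_setU ?xB1 ?orbT // negb_or yB1 andbT.
      apply/negP=> yA0.
      have [l li yl] : exists2 l, l != i & y = q l by apply: cap; rewrite // in_setU yA0.
      by case/negP: yB1; rewrite yl -off1 //; apply: pieced_mem (Pp _ _ PB1).
  have [d dB1] := Patt _ _ PB1 att1.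
  exists (dP + d); right; exists A0, q1, (B1 :|: B); split; last by rewrite setUA.
  + exact: up sA0.
  + by apply: piece_level_mono dB1; apply: leq_addl.
  + split=> // [x xA0|x y xA0].
      rewrite in_setU => /orP[xB1|xB]; first exact: cap1.
      by apply: cap; rewrite // in_setU xA0.
    rewrite !in_setU negb_or => /andP[xB1 xB] /orP[yB1|yB] yA0; first exact: sep1.
    case: (boolP (y \in B1)) => yB1; first exact: sep1.
    by apply: sep; rewrite // ?in_setU ?xA0 // negb_or yA0.
- case=> [sA /(IH _ _ i_s sA)[d dA]|]; first by exists d; left.
  case=> A0 [q1 [B1 [sA0 PB1 [off1 cap1 sep1] ->]]] [off cap sep].
  have pA0 : pieced q A0 by apply: piece_stage_pieced sA0.
  (* The outermost piece [B1] belongs to another label [j]; [B] is attached underneath it, to [A0],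
     and [B1] is put back afterwards. *)
  have att0 : attachable i q A0 q' B.
    split=> // [x xA0 xB|x y xA0 xB yB yA0].
      by apply: cap; rewrite // in_setU xA0.
    apply: sep; rewrite // in_setU ?xA0 // negb_or yA0.
    apply/negP=> yB1.
    have [l _ yl] : exists2 l, l != i & y = q l by apply: cap; rewrite // in_setU yB1 orbT.
    by case/negP: yA0; rewrite yl; apply: pieced_mem.
  have [d dA] := IH _ _ i_s sA0 att0.
  exists (d + dP); right; exists (A0 :|: B), q1, B1; split.
  + exact: up dA.
  + by apply: piece_level_mono (Pd _ _ PB1); apply: leq_addl.
  + split=> // [x|x y].
      rewrite in_setU => /orP[xA0|xB] xB1; first exact: cap1.
      have [l _ xl] : exists2 l, l != i & x = q l by apply: cap; rewrite // in_setU xB1 orbT.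
      by apply: cap1 => //; rewrite xl; apply: pieced_mem.
    rewrite !in_setU negb_or => /orP[xA0|xB] xB1 yB1 /andP[yA0 yB]; first exact: sep1.
    case: (boolP (x \in A0)) => xA0; first exact: sep1.
    by rewrite edge_sym; apply: sep; rewrite // ?in_setU ?yB1 ?orbT // negb_or xA0.
  + by rewrite setUAC.
Qed.

(** If the label [i] is occupied, its piece has a lower level, and [B] is attached to that piece by
    induction. *)
Lemma piece_level_attach d i q A q' B :
    piece_level d q A -> (exists d', piece_level d' q' B) -> attachable i q A q' B ->
  exists d', piece_level d' q (A :|: B).
Proof.
move=> dA ex_B att; elim: d q A dA att => // d IH q A dA att.
have [||||d' d'AB] := @piece_stage_attach _ _ i _ _ _ _ _ _ ex_B _ _ dA att.
- exact: piece_level_pieced.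
- exact: IH.
- by exists d.
- by rewrite mem_enum.
by exists d'.+1.
Qed.

Lemma pieced_level q X : pieced q X -> exists d, piece_level d q X.
Proof.
elim=> {q X} [q q_inj|i q A q' B _ [d dA] _ ex_B att].
  by exists 1 => /=; elim: (enum 'I_k) => [|j s IH] //=; left.
exact: piece_level_attach dA ex_B att.
Qed.

(** Up to isomorphism, [L] is the induced subgraph [F[X]] with the labels [q]. *)
Definition realises (L : labelled loops k) q X : Prop :=
  exists h : soe L -> F,
    [/\ embedding h, forall i, h (label L i) = q i & forall x, (x \in X) = (x \in codom h)].

Lemma realises_attach i A B LA LB q q' :
    injective q -> injective q' ->
    realises LA q A -> realises LB q' B -> attachable i q A q' B ->
  realises (attach i LA LB) q (A :|: B).
Proof.
move=> q_inj q'_inj [f [[f_inj f_edge] f_lab f_im]] [g [[g_inj g_edge] g_lab g_im]] [off cap sep].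
have fA x : f x \in A by rewrite f_im codom_f.
have gB y : g y \in B by rewrite g_im codom_f.
(* [q i] is a label of [A]; lying in [B] too, it would equal another label. *)
have qiB : q i \notin B.
  apply/negP=> qiB.
  have [|j ji /q_inj ij] := cap (q i) _ qiB; first by rewrite -f_lab.
  by rewrite ij eqxx in ji.
(* The fresh vertex is the one merged with the [i]-th label of [LA]. *)
pose b (y : soe (forget i LB)) : F := if y is Some v then g v else q i.
have ab j : f (label LA j) = b (label (forget i LB) j).
  rewrite f_lab /= /forget_label; case: (eqVneq j i) => [->//|ji] /=.
  by rewrite g_lab off.
have im_l z : z \in A -> exists x, z = f x.
  by rewrite f_im => /codomP.
have im_r z : z \in B -> exists y, z = g y by rewrite g_im => /codomP.
have imE z : (z \in A :|: B) = (z \in codom (glue_map f b)).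
  apply/idP/codomP => [|[w ->]].
    rewrite in_setU => /orP[/im_l|/im_r] [x ->].
      by exists (glue_l (forget i LB) x).
    by exists (glue_r LA (Some x : soe (forget i LB))); rewrite glue_map_r.
  case: (glue_cover w) => -[x ->]; first by rewrite in_setU /= fA.
  rewrite (glue_map_r ab) in_setU; case: x => [x|] /=; first by rewrite gB orbT.
  by rewrite -f_lab fA.
exists (glue_map f b); split=> //.
apply: glue_embedding => //.
- move=> [x|] [y|] //= e; first by rewrite (g_inj _ _ e).
    by rewrite -e gB in qiB.
  by rewrite e gB in qiB.
- move=> x [y|] /= e; last first.
    exists i; last by rewrite /forget_label eqxx.
    by apply: f_inj; rewrite f_lab.
  have [||j ji fxj] := cap (f x); rewrite ?fA //; first by rewrite e.
  exists j; first by apply: f_inj; rewrite f_lab.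
  rewrite /forget_label (negPf ji); congr Some; apply: g_inj.
  by rewrite g_lab off // -fxj e.
- by move=> x x'; rewrite f_edge.
- by move=> [x|] [x'|] //=; rewrite g_edge.
- move=> w w'; set z := glue_map f b w; set z' := glue_map f b w' => zz'.
  have : z \in A :|: B by rewrite imE codom_f.
  have : z' \in A :|: B by rewrite imE codom_f.
  have [/andP[/im_l[x zx] /im_l[x' zx']] _ _|nA] := boolP ((z \in A) && (z' \in A)).
    by left; exists x, x'; rewrite -f_edge -zx -zx'.
  have [/andP[/im_r[x zx] /im_r[x' zx']] _ _|nB] := boolP ((z \in B) && (z' \in B)).
    by right; exists (Some x), (Some x'); rewrite /= -g_edge -zx -zx'.
  (* Neither set contains both ends, so the edge joins [A :\: B] to [B :\: A], contradicting
     [sep]. *)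
  rewrite !in_setU => mz' mz; exfalso.
  case zA: (z \in A) nA mz => /= nA mz.
    rewrite (negPf nA) /= in mz'; rewrite mz' andbT in nB.
    by have := sep z z' zA nB mz' nA; rewrite zz'.
  rewrite mz /= in nB; rewrite (negPf nB) orbF in mz'.
  by have := sep z' z mz' nB mz (negbT zA); rewrite edge_sym zz'.
Qed.

Lemma realises_base q : injective q -> exists2 L, realises L q (q @: setT) & #|soe L| = k.
Proof.
move=> q_inj.
have sym : symmetric (fun i j : 'I_k => edge F (q i) (q j)) by move=> i j; apply: edge_sym.
have irr : ~~ loops -> irreflexive (fun i j : 'I_k => edge F (q i) (q j)).
  by move=> nl i; apply: edge_irr.
exists (@Labelled loops k (@Graph loops 'I_k _ sym irr) id (fun _ _ => id)); last exact: card_ord.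
exists q; split=> // x; apply/imsetP/codomP => -[i]; first by move=> _ ->; exists i.
by move->; exists i.
Qed.

Lemma piece_stage_realised P (Q : labelled loops k -> Prop) s q X :
    (forall q' B, P q' B -> pieced q' B) ->
    (forall q' B, P q' B -> exists2 L, realises L q' B & Q L) ->
    piece_stage P s q X ->
  exists2 L, realises L q X & stage Q s L.
Proof.
move=> Pp PQ; elim: s q X => [|i s IH] q X /=.
  by case=> q_inj ->; apply: realises_base.
case=> [/IH[L ? ?]|[A [q' [B [sA PB att ->]]]]]; first by exists L => //; left.
have [LA qLA sLA] := IH _ _ sA; have [LB qLB QLB] := PQ _ _ PB.
exists (attach i LA LB); last by right; exists LA, LB.
apply: realises_attach att => //; last exact: pieced_inj (Pp _ _ PB).
by apply: pieced_inj; apply: piece_stage_pieced sA.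
Qed.

Lemma piece_level_realised d q X :
  piece_level d q X -> exists2 L, realises L q X & level d L.
Proof.
elim: d q X => // d IH q X; apply: piece_stage_realised => //.
exact: piece_level_pieced.
Qed.

Lemma pieced_level_isomorphic q :
  pieced q setT -> exists d (L : labelled loops k), level d L /\ isomorphic (soe L) F.
Proof.
move/pieced_level=> [d /piece_level_realised[L [h [h_emb _ h_im]] dL]].
exists d, L; split=> //; apply: (embedding_isomorphic h_emb) => y.
by have := h_im y; rewrite in_setT => /esym/codomP[x ->]; exists x.
Qed.

End Pieces.

(** * Cutting a tree at an edge *)

Lemma connect_homo (S T : finType) (e : rel S) (e' : rel T) (f : S -> T) a b :
    (forall x y, e x y -> connect e' (f x) (f y)) ->
  connect e a b -> connect e' (f a) (f b).
Proof.
move=> ef /connectP[p]; elim: p a => [a _ ->|x p IH a /= /andP[/ef eax xp] bE].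
  exact: connect0.
exact: connect_trans eax (IH _ xp bE).
Qed.

Section Cuts.
Variables (T : finType) (e : rel T).
Hypothesis e_sym : symmetric e.
Implicit Types (Q D : {set T}).

Definition connected_in Q : Prop :=
  forall a b, a \in Q -> b \in Q -> connect [rel x y | [&& e x y, x \in Q & y \in Q]] a b.

(** In a tree, [D] is the component of [s'] after deletion of the edge between [s] and [s']. *)
Definition cut_edge D s s' : Prop :=
  forall x y, e x y -> x \notin D -> y \in D -> x = s /\ y = s'.

Lemma cut_edgeC D s s' : cut_edge D s s' -> cut_edge (~: D) s' s.
Proof.
by move=> cut x y exy; rewrite !in_setC negbK => xD yD; case: (cut y x) => //; rewrite e_sym.
Qed.

(** A path can leave and enter [D] only at [s'], so collapsing everything outside [D] to [s'] keeps
    it a walk, now inside [D]. *)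
Lemma cut_connected Q D s s' : cut_edge D s s' -> connected_in Q -> connected_in (Q :&: D).
Proof.
move=> cut Q_conn a b; rewrite !in_setI => /andP[aQ aD] /andP[bQ bD].
pose f x := if x \in D then x else s'.
have -> : a = f a by rewrite /f aD.
have -> : b = f b by rewrite /f bD.
apply: connect_homo (Q_conn a b aQ bQ) => x y /= /and3P[exy xQ yQ]; rewrite /f.
case: (boolP (x \in D)) => xD; case: (boolP (y \in D)) => yD //.
- by apply: connect1; rewrite /= exy !in_setI xQ yQ xD yD.
- by have [_ ->] : y = s /\ x = s' by apply: cut => //; rewrite e_sym.
- by have [_ ->] : x = s /\ y = s' by apply: cut.
Qed.

(** The first edge with which a path in [Q] enters [D] is the cut edge. *)
Lemma cut_edge_in Q D s s' a b :
    cut_edge D s s' -> connected_in Q -> a \in Q -> b \in Q -> a \notin D -> b \in D ->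
  s \in Q /\ s' \in Q.
Proof.
move=> cut Q_conn aQ bQ aD bD.
have /connectP[p] := Q_conn a b aQ bQ.
elim: p a aD {aQ} => [a aD _ bE|x p IH a aD /= /andP[/and3P[eax aQ xQ] xp] bE].
  by rewrite bE /= (negPf aD) in bD.
case: (boolP (x \in D)) => xD; last exact: IH xD xp bE.
by have [<- <-] := cut _ _ eax aD xD.
Qed.

Hypothesis e_irr : irreflexive e.
Hypothesis e_acyclic : forall c : seq T, ucycle e c -> size c < 3.

(** If the component of [s'] still contained [s], a path between them would close up to a cycle with
    the deleted edge. *)
Lemma tree_cut s s' : e s s' ->
  exists D, [/\ s \notin D, s' \in D & cut_edge D s s'].
Proof.
move=> ss'.
pose e' := [rel x y | e x y && ~~ ((x == s) && (y == s') || (x == s') && (y == s))].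
pose D := [set t | connect e' s' t].
have sD : s \notin D.
  rewrite inE; apply/negP=> /connectP[p0 p0_path].
  case/shortenP: p0_path => p p_path p_uniq _ sE.
  have e_path : path e s' p by apply: sub_path p_path => x y /andP[].
  have : ucycle e (s' :: p) by rewrite /ucycle /= rcons_path e_path -sE ss'.
  (* Fewer than three vertices leave two cases: [s = s'], or a path that uses the deleted edge
     itself. *)
  move/e_acyclic; case: p p_path sE {p_uniq e_path} => [|x [|y p]] //=.
    by move=> _ sE; rewrite sE e_irr in ss'.
  by rewrite andbT => /andP[_ h] sE; rewrite -sE !eqxx orbT in h.
exists D; split=> //; first by rewrite inE connect0.
move=> x y exy xD yD.
have : ~~ e' y x.
  by apply: contra xD => yx; move: yD; rewrite !inE => /connect_trans; apply; apply: connect1.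
rewrite /= e_sym exy /= negbK => /orP[/andP[/eqP ys _]|/andP[/eqP -> /eqP ->]] //.
by rewrite ys (negPf sD) in yD.
Qed.

End Cuts.

(** * Building a graph along its tree decomposition *)

Section TreeDecomposition.
Variables (loops : bool) (k : nat) (F : graph loops) (T : finType) (e : rel T).
Variable bag : T -> {set F}.
Hypothesis e_sym : symmetric e.
Hypothesis e_irr : irreflexive e.
Hypothesis e_acyclic : forall c : seq T, ucycle e c -> size c < 3.
Hypothesis bag_card : forall t, #|bag t| <= k.
Implicit Types (S : {set T}) (q : 'I_k -> F).

Let nodes (x : F) : {set T} := [set t | x \in bag t].
Let covered S : {set F} := \bigcup_(t in S) bag t.

Lemma coveredP S x : reflect (exists2 t, t \in S & x \in bag t) (x \in covered S).
Proof. exact: bigcupP. Qed.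

Lemma im_labelP q x : reflect (exists j, x = q j) (x \in q @: setT).
Proof. by apply: (iffP imsetP) => [[j _ ->]|[j ->]]; exists j. Qed.

(** The hypothesis on edges says that [covered S :\: q @: setT] is separated by
    [q @: setT] from the rest of [F].  While [bag s] is not contained in
    [q @: setT], a label outside [bag s] is moved into it; after that, [S] is cut
    at an edge of the tree that leaves [s]. *)
Lemma subtree_pieced S s q :
    s \in S -> injective q -> connected_in e S ->
    (forall x, connected_in e (S :&: nodes x)) ->
    (forall j, q j \in covered S -> q j \in bag s) ->
    (forall x y, edge F x y -> x \in covered S -> x \notin q @: setT ->
       exists t, [/\ t \in S, x \in bag t & y \in bag t]) ->
  pieced q (covered S :|: q @: setT).
Proof.
(* The outer induction is on the size of [S], the inner one on the number of vertices of [bag s]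
   that are not labels. *)
have [m] := ubnP #|S|; elim: m => // m IHm in S s q * => /ltnSE-S_m.
have [r] := ubnP #|bag s :\: q @: setT|; elim: r => // r IHr in q * => /ltnSE-r_bag.
move=> sS q_inj S_conn nodes_conn q_bag q_edge.
have [bag_q|] := boolP (bag s \subset q @: setT); last first.
  case/subsetPn=> v v_bag v_q.
  have v_S : v \in covered S by apply/coveredP; exists s.
  (* Otherwise all [k] labels and [v] would lie in [bag s], which has at most [k] vertices. *)
  have [i qi_bag] : exists i, q i \notin bag s.
    apply/existsP; rewrite -negb_forall; apply/negP=> /forallP q_sub.
    have : q @: setT \proper bag s.
      apply/properP; split; last by exists v.
      by apply/subsetP=> _ /im_labelP[j ->].
    move/proper_card; rewrite card_imset // cardsT card_ord => /leq_trans.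
    by move/(_ _ (bag_card s)); rewrite ltnn.
  pose q' j := if j == i then v else q j.
  have q'i : q' i = v by rewrite /q' eqxx.
  have q'j j : j != i -> q' j = q j by rewrite /q' => /negPf->.
  have q'_inj : injective q'.
    move=> j j'; rewrite /q'; case: eqP => [->|_]; case: eqP => [->|_] //.
    - by move=> vq; case/negP: v_q; apply/im_labelP; exists j'.
    - by move=> vq; case/negP: v_q; apply/im_labelP; exists j.
    - exact: q_inj.
  have q'_S j : q' j \in covered S -> q' j \in bag s.
    by case: (eqVneq j i) => [->|/q'j ->]; [rewrite q'i | apply: q_bag].
  have q_q' x : x \in q @: setT -> x != q i -> x \in q' @: setT.
    case/im_labelP=> j ->; case: (eqVneq j i) => [->|ji _]; first by rewrite eqxx.
    by apply/im_labelP; exists j; rewrite q'j.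
  have qi_S : q i \notin covered S by apply: contra qi_bag; apply: q_bag.
  have S_qi x : x \in covered S -> x != q i by apply: contraTneq => ->.
  have pieced' : pieced q' (covered S :|: q' @: setT).
    apply: IHr => // [|x y xy xS xq'].
      apply: leq_trans r_bag; apply: proper_card; apply/properP; split.
        apply/subsetP=> x; rewrite !in_setD => /andP[xq' xs]; rewrite xs andbT.
        apply: contra xq' => /q_q'; apply; apply: S_qi; apply/coveredP; by exists s.
      exists v; first by rewrite in_setD v_q.
      by rewrite in_setD negb_and negbK -q'i imset_f.
    apply: q_edge => //; apply: contra xq' => /q_q'; apply; exact: S_qi.
  (* The base piece of the old labels keeps [q i], which [S] does not cover; the piece labelled by
     [q'] is attached to it at [i]. *)
  have -> : covered S :|: q @: setT = q @: setT :|: (covered S :|: q' @: setT).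
    apply/setP=> x; rewrite !in_setU; case: (boolP (x \in q @: setT)) => [|xq]; rewrite ?orbT //=.
    case: (boolP (x \in covered S)) => //= xS; apply/esym/negP=> /im_labelP[j xj].
    move: xS xq; rewrite xj; case: (eqVneq j i) => [->|/q'j ->]; first by rewrite q'i v_S.
    by move=> _ /im_labelP[]; exists j.
  apply: (pieced_attach (pieced_base q_inj) pieced' (i := i)); split=> // [x|x y].
    case/im_labelP=> j ->; rewrite in_setU => /orP[jS|/im_labelP[j' jj']].
      by exists j => //; apply: contraNneq qi_S => <-.
    case: (eqVneq j i) jj' => [->|ji _]; last by exists j.
    case: (eqVneq j' i) => [->|j'i]; last by rewrite q'j // => /q_inj ij'; rewrite ij' eqxx in j'i.
    by rewrite q'i => qiv; case/negP: v_q; apply/im_labelP; exists i.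
  move=> xq; rewrite in_setU negb_or => /andP[xS xq'].
  rewrite in_setU => /orP[yS|/im_labelP[j ->]] yq; last first.
    move: yq; case: (eqVneq j i) => [->|/q'j ->]; last by case/im_labelP; exists j.
    rewrite q'i => _; apply/negP; rewrite edge_sym => vx.
    have [t [tS _ xt]] := q_edge _ _ vx v_S v_q.
    by case/coveredP: xS; exists t.
  apply/negP; rewrite edge_sym => yx.
  have [t [tS _ xt]] := q_edge _ _ yx yS yq.
  by case/coveredP: xS; exists t.
(* From here on [bag s] consists of labels. If no edge leaves [s] inside [S], then [S] is just [s]
   and only labels are covered. *)
have [/existsP[s' /andP[s'S ss']]|no_s'] := boolP [exists s', (s' \in S) && e s s']; last first.
  have S_s t : t \in S -> t = s.
    move=> tS; have /connectP[[|x p] //= /andP[/and3P[sx _ xS] _] _] := S_conn s t sS tS.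
    by case/existsP: no_s'; exists x; rewrite xS.
  suff /setUidPr -> : covered S \subset q @: setT by apply: pieced_base.
  by apply/bigcupsP=> t /S_s ->.
have [D [sD s'D cut]] := tree_cut e_sym e_irr e_acyclic ss'.
have cutC := cut_edgeC e_sym cut.
have in_S1 t : (t \in S :&: ~: D) = (t \in S) && (t \notin D) by rewrite in_setI in_setC.
have in_S2 t : (t \in S :&: D) = (t \in S) && (t \in D) by rewrite in_setI.
(* A vertex covered on both sides of the cut lies in the bags at both ends of the cut edge, because
   its nodes are connected; being in [bag s], it is a label. *)
have both x t1 t2 : t1 \in S -> t1 \notin D -> x \in bag t1 ->
    t2 \in S -> t2 \in D -> x \in bag t2 -> x \in bag s /\ x \in bag s'.
  move=> t1S t1D xt1 t2S t2D xt2.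
  have [] := @cut_edge_in _ e (S :&: nodes x) D s s' t1 t2 cut (nodes_conn x);
    by rewrite ?in_setI ?inE ?t1S ?t2S // => /andP[_ ?] /andP[_ ?].
have nodesI E x : S :&: E :&: nodes x = S :&: nodes x :&: E by rewrite setIAC.
have pieced1 : pieced q (covered (S :&: ~: D) :|: q @: setT).
  apply: (IHm _ s) => //.
  - apply: leq_trans S_m; apply: proper_card; apply/properP; split; first exact: subsetIl.
    by exists s'; rewrite // in_S1 s'D andbF.
  - by rewrite in_S1 sS.
  - exact: cut_connected cutC S_conn.
  - by move=> x; rewrite nodesI; apply: cut_connected cutC (nodes_conn x).
  - move=> j /coveredP[t]; rewrite in_S1 => /andP[tS _] qt.
    by apply: q_bag; apply/coveredP; exists t.
  - move=> x y xy /coveredP[t]; rewrite in_S1 => /andP[tS tD] xt xq.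
    have [|t' [t'S xt' yt']] := q_edge _ _ xy _ xq; first by apply/coveredP; exists t.
    exists t'; rewrite in_S1 t'S; split=> //; apply/negP=> t'D.
    by case/negP: xq; apply: (subsetP bag_q); have [] := both x t t'.
have pieced2 : pieced q (covered (S :&: D) :|: q @: setT).
  apply: (IHm _ s') => //.
  - apply: leq_trans S_m; apply: proper_card; apply/properP; split; first exact: subsetIl.
    by exists s; rewrite // in_S2 (negPf sD) andbF.
  - by rewrite in_S2 s'S.
  - exact: cut_connected cut S_conn.
  - by move=> x; rewrite nodesI; apply: cut_connected cut (nodes_conn x).
  - move=> j /coveredP[t]; rewrite in_S2 => /andP[tS tD] qt.
    have qs : q j \in bag s by apply: q_bag; apply/coveredP; exists t.
    by have [] := both (q j) s t.
  - move=> x y xy /coveredP[t]; rewrite in_S2 => /andP[tS tD] xt xq.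
    have [|t' [t'S xt' yt']] := q_edge _ _ xy _ xq; first by apply/coveredP; exists t.
    exists t'; rewrite in_S2 t'S; split=> //; apply: contraNT xq => t'D.
    by apply: (subsetP bag_q); have [] := both x t' t.
have -> : covered S :|: q @: setT =
    (covered (S :&: ~: D) :|: q @: setT) :|: (covered (S :&: D) :|: q @: setT).
  rewrite setUACA setUid; congr (_ :|: _).
  by rewrite /covered -bigcup_setU -setIUr setUC setUCr setIT.
apply: pieced_union => // [x|x y].
  rewrite !in_setU => /orP[/coveredP[t1]|/im_labelP //]; rewrite in_S1 => /andP[t1S t1D] xt1.
  move=> /orP[/coveredP[t2]|/im_labelP //]; rewrite in_S2 => /andP[t2S t2D] xt2.
  by apply/im_labelP; apply: (subsetP bag_q); have [] := both x t1 t2.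
rewrite !in_setU !negb_or => /orP[xS1 /andP[xS2 xq]|->]; last by rewrite andbF.
move=> /orP[yS2 /andP[yS1 yq]|->]; last by rewrite andbF.
apply/negP=> xy; case/coveredP: xS1 => t1; rewrite in_S1 => /andP[t1S t1D] xt1.
have [|t [tS xt yt]] := q_edge _ _ xy _ xq; first by apply/coveredP; exists t1.
case: (boolP (t \in D)) => tD.
  by case/coveredP: xS2; exists t; rewrite // in_S2 tS.
by case/coveredP: yS1; exists t; rewrite // in_S1 tS.
Qed.

End TreeDecomposition.

Section Treewidth.
Variables (loops : bool) (k : nat) (F : graph loops) (T : finType) (e : rel T).
Hypothesis e_sym : symmetric e.
Hypothesis e_irr : irreflexive e.
Hypothesis e_acyclic : forall c : seq T, ucycle e c -> size c < 3.
Hypothesis e_conn : connected_in e setT.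

(** While the largest bag [bag t0] has fewer than [k] vertices, some vertex outside it is added to
    every bag, and [t0] stays maximal. Once it has [k] vertices, they serve as the labels. *)
Lemma decomposition_pieced (bag : T -> {set F}) (t0 : T) :
    #|bag t0| <= k ->
    (forall t, #|bag t| <= #|bag t0|) ->
    (forall x, exists t, x \in bag t) ->
    (forall x y, edge F x y -> exists t, x \in bag t /\ y \in bag t) ->
    (forall x, connected_in e [set t | x \in bag t]) ->
    k <= #|F| ->
  exists q : 'I_k -> F, pieced q setT.
Proof.
move=> + + + + + k_F.
have [m] := ubnP (k - #|bag t0|); elim: m => // m IHm in bag * => /ltnSE-m_bag.
move=> bag0_k bag_max bag_cover bag_edge bag_conn.
have bag_card t : #|bag t| <= k by apply: leq_trans (bag_max t) bag0_k.
have [k_bag|bag_k] := leqP k #|bag t0|.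
  have bagE : #|bag t0| = k by apply/eqP; rewrite eqn_leq bag_card.
  pose q (j : 'I_k) : F := enum_val (cast_ord (esym bagE) j).
  have q_inj : injective q by move=> i j /enum_val_inj /cast_ord_inj.
  exists q.
  have -> : [set: F] = \bigcup_(t in setT) bag t :|: q @: setT.
    apply/esym/setP=> x; rewrite in_setU in_setT; apply/orP; left.
    by apply/bigcupP; have [t xt] := bag_cover x; exists t.
  apply: (subtree_pieced e_sym e_irr e_acyclic bag_card (s := t0)) => //.
  - by move=> x; rewrite setTI; apply: bag_conn.
  - by move=> j _; apply: enum_valP.
  - by move=> x y xy _ _; have [t [xt yt]] := bag_edge _ _ xy; exists t.
have [x x_bag] : exists x, x \notin bag t0.
  apply/existsP; rewrite -negb_forall; apply: contraL bag_k => /forallP all_bag.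
  by rewrite -leqNgt (leq_trans k_F) //; apply/subset_leq_card/subsetP.
apply: (IHm (fun t => x |: bag t)) => //.
- by rewrite cardsU1 x_bag add1n; apply: leq_trans m_bag; rewrite ltn_sub2l.
- by rewrite cardsU1 x_bag.
- by move=> t; rewrite !cardsU1 x_bag; apply: leq_add (leq_b1 _) (bag_max t).
- by move=> y; have [t yt] := bag_cover y; exists t; rewrite in_setU yt orbT.
- by move=> y z /bag_edge[t [yt zt]]; exists t; rewrite !in_setU yt zt !orbT.
- move=> y; case: (eqVneq y x) => [->|yx].
    have -> : [set t | x \in x |: bag t] = setT; last exact: e_conn.
    by apply/setP=> t; rewrite !inE eqxx.
  have -> : [set t | y \in x |: bag t] = [set t | y \in bag t]; last exact: bag_conn.
  by apply/setP=> t; rewrite !inE (negPf yx).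
Qed.

End Treewidth.

Lemma treewidth_pieced (loops : bool) (k : nat) (F : graph loops) :
    0 < k -> treewidth_at_most F (k - 1) -> k <= #|F| ->
  exists q : 'I_k -> F, pieced q setT.
Proof.
move=> k_gt0 [T [bag [[[[T_gt0 T_conn] T_acyclic] bag_cover bag_edge bag_conn] bag_card]]] k_F.
have [t1 _] := card_gt0P T_gt0.
pose t0 := [arg max_(t > t1) #|bag t|].
have bag_max t : #|bag t| <= #|bag t0| by rewrite /t0; case: arg_maxnP => // t2 _; apply.
apply: (@decomposition_pieced _ k F T (edge T) _ _ _ _ bag t0) => //.
- exact: edge_sym.
- exact: edge_irr.
- move=> a b _ _; apply: (@connect_homo _ _ _ _ id) (T_conn a b) => x y xy; apply: connect1.
  by rewrite /= xy !in_setT.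
- by apply: leq_trans (bag_card t0) _; rewrite subn1 prednK.
- move=> x a b; rewrite !inE => xa xb.
  apply: (@connect_homo _ _ _ _ id) (bag_conn x a b xa xb) => s t /= /and3P[st xs xt].
  by apply: connect1; rewrite /= st !inE xs.
Qed.

(** * The size bound *)

Lemma hom_void (loops : bool) (F G H : graph loops) :
  #|G| = 0 -> #|H| = 0 -> hom F G = hom F H.
Proof.
have homE (K : graph loops) : #|K| = 0 -> hom F K = 0 ^ #|F|.
  move=> K0; rewrite /hom -K0 -card_ffun; apply: eq_card => h.
  by rewrite !inE; apply/is_homP=> u; have := card0_eq K0 (h u); rewrite inE.
by move=> G0 H0; rewrite !homE.
Qed.

Theorem theorem19 (loops : bool) (k C : nat) (FF : graph_class loops)
    (k_ge1 : 1 <= k)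
    (FF_iso : iso_closed FF)
    (FF_tw : forall F : graph loops, FF F -> treewidth_at_most F (k - 1))
    (FF_index : recognisability_index k FF C)
    (n : nat) (G H : graph loops)
    (G_le_n : #|G| <= n) (H_le_n : #|H| <= n) :
  hom_indist FF G H <-> hom_indist (class_le FF (size_bound n k C)) G H.
Proof.
split=> [GH F [FF_F _]|GH F FF_F]; first exact: GH.
case: FF_index => rep rep_unique.
(* For [n = 0] the bound is only 1, but then [G] and [H] are both empty and receive equally many
   homomorphisms from any graph. *)
case: (posnP n) => [n0|n_gt0].
  by apply: hom_void; apply/eqP; rewrite -leqn0 -n0.
have bound_mono d : d <= 2 * C * n ^ k -> maxn (k ^ d) d <= size_bound n k C.
  by move=> dle; rewrite geq_max !leq_max leq_pexp2l // dle orbT.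
have C_gt0 : 0 < C.
  by have [[i iC] _] := rep_unique (edgeless loops k); apply: leq_ltn_trans iC.
(* A graph with fewer than [k] vertices has no injective labelling; it satisfies the size bound
   because [2 * C * n ^ k] is positive. *)
case: (ltnP #|F| k) => [F_k|k_F].
  apply: GH; split=> //; apply: leq_trans (ltnW F_k) (leq_trans _ (bound_mono 1 _)).
    by rewrite expn1 leq_maxl.
  by rewrite !muln_gt0 C_gt0 expn_gt0 n_gt0.
have [q /pieced_level_isomorphic[e [L [eL LF]]]] := treewidth_pieced k_ge1 (FF_tw _ FF_F) k_F.
have [d d_le d_hom] := level_hom_eq FF_iso rep_unique G H.
rewrite -!(hom_iso _ LF); apply: (d_hom _ _ _ eL).
  move=> L' dL' FF_L'; apply: GH; split=> //.
  apply: leq_trans (level_card k_ge1 dL') (bound_mono _ (leq_trans d_le _)).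
  (* The vectors have [#|G| ^ k + #|H| ^ k] coordinates, at most [2 * n ^ k]. *)
  rewrite [2 * C]mulnC -mulnA mul2n -addnn leq_mul2l; apply/orP; right.
  by rewrite card_sum !card_ffun card_ord leq_add // leq_exp2r.
by apply: FF_iso FF_F; apply: isomorphic_sym.
Qed.
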